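(* Every tangential hypersurface of an almost product-like Riemannian manifold is a para contact-like metric manifold. That is, if $(M,g)$ is a tangential hypersurface, with unit normal vector field $N$, of an almost product-like Riemannian manifold $(\widetilde{M},\widetilde{g},F)$, and $(\varphi,\varphi^{\ast},\xi,\xi^{\ast},\eta,\eta^{\ast})$ is the induced structure on $M$, then $(M,g,\varphi,\varphi^{\ast},\xi,\xi^{\ast},\eta,\eta^{\ast})$ is a para contact-like metric manifold.
   Context: An almost product-like Riemannian manifold $(\widetilde{M},\widetilde{g},F)$ is a Riemannian manifold $(\widetilde{M},\widetilde{g})$ with a $(1,1)$-tensor field $F$ satisfying $F^{2}=I$, together with another $(1,1)$-tensor field $F^{\ast}$ satisfying $\widetilde{g}(FX,Y)=\widetilde{g}(X,F^{\ast}Y)$ for all vector fields $X,Y$ on $\widetilde{M}$. A hypersurface $(M,g)$ (induced metric $g$, unit normal vector field $N$) is tangential if $FN$ and $F^{\ast}N$ are tangent to $M$. The induced structure is given by $\xi=FN$, $\xi^{\ast}=F^{\ast}N$ and, for $X\in\Gamma(TM)$, $FX=\varphi X+\eta^{\ast}(X)N$, $F^{\ast}X=\varphi^{\ast}X+\eta(X)N$ with $\varphi X,\varphi^{\ast}X$ tangent to $M$. A Riemannian manifold $(M,g)$ is an almost para contact-like manifold if it carries $(1,1)$-tensor fields $\varphi,\varphi^{\ast}$, vector fields $\xi,\xi^{\ast}$ and $1$-forms $\eta,\eta^{\ast}$ such that $$\varphi^{2}=I-\eta^{\ast}\otimes\xi,\quad \varphi\xi=0,\quad \eta(\xi^{\ast})=1,\quad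 \eta\circ\varphi^{\ast}=0,$$ $$(\varphi^{\ast})^{2}=I-\eta\otimes\xi^{\ast},\quad \varphi^{\ast}\xi^{\ast}=0,\quad \eta^{\ast}(\xi)=1,\quad \eta^{\ast}\circ\varphi=0.$$ It is a para contact-like metric manifold if in addition $g(\varphi X,\varphi^{\ast}Y)=g(X,Y)-\eta^{\ast}(X)\eta(Y)$ for all $X,Y\in\Gamma(TM)$. *)

(* Defs.v *)
From mathcomp Require Import all_boot all_order all_algebra.
From mathcomp Require Import all_classical all_reals all_analysis.

Set Implicit Arguments.
Unset Strict Implicit.
Unset Printing Implicit Defensive.

Import Order.TTheory GRing.Theory Num.Theory.
Import numFieldNormedType.Exports.

Local Open Scope classical_set_scope.
Local Open Scope ring_scope.

(* [f] is of class C^k on [U]; meant for open [U]. *)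
Fixpoint class_C (R : realType) (V W : normedModType R) (k : nat) (U : set V)
    (f : V -> W) : Prop :=
  if k is k'.+1 then
    (forall x, U x -> differentiable f x) /\
    (forall v, class_C k' U (fun x => 'd f x v))
  else forall x, U x -> {for x, continuous f}.

Definition smooth_on (R : realType) (V W : normedModType R) (U : set V)
    (f : V -> W) : Prop :=
  forall k, class_C k U f.

(* A homeomorphism from the open set [csrc] onto the open set [ctgt]; the two
   maps are total, and their values outside these sets are irrelevant. *)
Record chart (R : realType) (n : nat) (T : topologicalType) := Chart {
  csrc : set T;
  ctgt : set 'rV[R]_n;
  cfun :> T -> 'rV[R]_n;
  cinv : 'rV[R]_n -> T;
  csrc_open : open csrc;
  ctgt_open : open ctgt;
  cfun_tgt : forall p, csrc p -> ctgt (cfun p);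
  cinv_src : forall x, ctgt x -> csrc (cinv x);
  cfunK : forall p, csrc p -> cinv (cfun p) = p;
  cinvK : forall x, ctgt x -> cfun (cinv x) = x;
  cfun_cont : forall p, csrc p -> {for p, continuous cfun};
  cinv_cont : forall x, ctgt x -> {for x, continuous cinv}
}.

(* The atlas need not be maximal. *)
Record manifold (R : realType) (n : nat) := Manifold {
  msort :> topologicalType;
  m_hausdorff : hausdorff_space msort;
  m_second_countable : second_countable (T := msort);
  atlas : set (chart R n msort);
  chart_at : msort -> chart R n msort;
  chart_at_atlas : forall p, atlas (chart_at p);
  chart_at_src : forall p, csrc (chart_at p) p;
  atlas_compat : forall c d, atlas c -> atlas d ->
    smooth_on (ctgt c `&` cinv c @^-1` csrc d) (d \o cinv c)
}.

(* The tangent space at [p] is identified with R^n by means of the preferred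
   chart [chart_at p]; [coord] and [frame] below convert to and from the
   coordinates in an arbitrary chart around [p]. *)
Definition tangent (R : realType) (n : nat) (M : manifold R n) (p : M) :
  lmodType R := 'rV[R]_n.

Section Fields.
Variables (R : realType) (n : nat) (M : manifold R n).
Implicit Types (c : chart R n M) (p : M).

(* Coordinates, in the chart [c] around [p], of a tangent vector at [p]. *)
Definition coord c p (v : tangent p) : 'rV[R]_n :=
  'd (c \o cinv (chart_at p)) (chart_at p p) v.

(* The tangent vector at [p] with given coordinates in the chart [c]. *)
Definition frame c p (u : 'rV[R]_n) : tangent p :=
  'd (chart_at p \o cinv c) (c p) u.

Definition is_vector_field (X : forall p, tangent p) : Prop :=
  forall c, atlas c ->
    smooth_on (ctgt c) (fun x => coord c (X (cinv c x))).

Definition is_one_form (eta : forall p, tangent p -> R) : Prop :=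
  (forall p, scalar (eta p)) /\
  (forall c, atlas c -> forall u,
    smooth_on (ctgt c) (fun x => eta (cinv c x) (frame c _ u) : R^o)).

Definition is_tensor11 (phi : forall p, tangent p -> tangent p) : Prop :=
  (forall p, linear (phi p)) /\
  (forall c, atlas c -> forall u,
    smooth_on (ctgt c)
      (fun x => coord c (phi (cinv c x) (frame c _ u)))).

Definition is_riemannian (g : forall p, tangent p -> tangent p -> R) : Prop :=
  [/\ forall p X, scalar (g p X),
      forall p X Y, g p X Y = g p Y X,
      forall p (X : tangent p), X != 0 -> 0 < g p X X &
      forall c, atlas c -> forall u v,
        smooth_on (ctgt c)
          (fun x => g (cinv c x) (frame c _ u) (frame c _ v) : R^o)].

(* Identities between tensor fields are read pointwise. *)
Definition almost_product_like (g : forall p, tangent p -> tangent p -> R)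
    (F Fs : forall p, tangent p -> tangent p) : Prop :=
  [/\ is_riemannian g,
      is_tensor11 F, is_tensor11 Fs,
      forall p X, F p (F p X) = X &
      forall p X Y, g p (F p X) Y = g p X (Fs p Y)].

(* Raw data; the suffix [s] stands for the asterisk of the usual notation. *)
Record para_data := ParaData {
  phi : forall p, tangent p -> tangent p;
  phis : forall p, tangent p -> tangent p;
  xi : forall p, tangent p;
  xis : forall p, tangent p;
  eta : forall p, tangent p -> R;
  etas : forall p, tangent p -> R
}.

Definition almost_para_contact_like
    (g : forall p, tangent p -> tangent p -> R) (S : para_data) : Prop :=
  is_riemannian g /\
  [/\ is_tensor11 (phi S), is_tensor11 (phis S),
      is_vector_field (xi S) /\ is_vector_field (xis S) &
      is_one_form (eta S) /\ is_one_form (etas S)] /\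
  [/\ forall p X, phi S (phi S X) = X - etas S X *: xi S p,
      forall p, phi S (xi S p) = 0,
      forall p, eta S (xis S p) = 1 &
      forall p (X : tangent p), eta S (phis S X) = 0] /\
  [/\ forall p X, phis S (phis S X) = X - eta S X *: xis S p,
      forall p, phis S (xis S p) = 0,
      forall p, etas S (xi S p) = 1 &
      forall p (X : tangent p), etas S (phi S X) = 0].

Definition para_contact_like_metric
    (g : forall p, tangent p -> tangent p -> R) (S : para_data) : Prop :=
  almost_para_contact_like g S /\
  forall p X Y, g p (phi S X) (phis S Y) = g p X Y - etas S X * eta S Y.

End Fields.

Section Maps.
Variables (R : realType) (m n : nat) (M : manifold R m) (N : manifold R n).

Definition is_smooth_map (f : M -> N) : Prop :=
  continuous f /\
  forall c d, atlas c -> atlas d ->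
    smooth_on (ctgt c `&` (f \o cinv c) @^-1` csrc d) (d \o f \o cinv c).

Definition differential (f : M -> N) (p : M) (v : tangent p) :
    tangent (f p) :=
  'd (chart_at (f p) \o f \o cinv (chart_at p)) (chart_at p p) v.

Definition is_immersion (f : M -> N) : Prop :=
  is_smooth_map f /\ forall p, injective (@differential f p).

Definition is_vector_field_along (f : M -> N)
    (X : forall p, tangent (f p)) : Prop :=
  forall c d, atlas c -> atlas d ->
    smooth_on (ctgt c `&` (f \o cinv c) @^-1` csrc d)
      (fun x => coord d (X (cinv c x))).

End Maps.

Section Hypersurfaces.
Variables (R : realType) (n : nat) (M : manifold R n) (Mt : manifold R n.+1).
Variables (gt : forall q : Mt, tangent q -> tangent q -> R).
Variables (F Fs : forall q : Mt, tangent q -> tangent q).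
Variables (f : M -> Mt) (N : forall p, tangent (f p)).

(* The hypersurface is the (immersed) image of [f]; [M] carries the metric
   [induced_metric]. *)
Definition is_hypersurface : Prop :=
  [/\ is_immersion f,
      is_vector_field_along N,
      forall p, gt (N p) (N p) = 1 &
      forall p (X : tangent p), gt (differential f X) (N p) = 0].

Definition induced_metric (p : M) (X Y : tangent p) : R :=
  gt (differential f X) (differential f Y).

Definition is_tangential : Prop :=
  forall p, (exists X : tangent p, differential f X = F (N p)) /\
            (exists X : tangent p, differential f X = Fs (N p)).

Definition is_induced_structure (S : para_data M) : Prop :=
  [/\ forall p, F (N p) = differential f (xi S p),
      forall p, Fs (N p) = differential f (xis S p),
      forall p (X : tangent p), F (differential f X) =
        differential f (phi S X) + etas S X *: N p &
      forall p (X : tangent p), Fs (differential f X) =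
        differential f (phis S X) + eta S X *: N p].

End Hypersurfaces.

(* Main.v *)
(** The metric determines every induced object: writing [df] for the
differential of the immersion,
[etas X = gt (F (df X)) N], [g (phi X) Y = gt (F (df X)) (df Y)] and
[g xi Y = gt (F N) (df Y)], and similarly for the starred objects and [Fs].
The right-hand sides are smooth in charts, so inverting the Gram matrix of the
induced metric gives smoothness of [phi], [xi] and [etas].  The algebraic
identities come from comparing tangential and normal parts in [F (F X) = X],
applied to [X = df Y] and [X = N], and from
[gt (F X) (Fs Y) = gt (F (F X)) Y = gt X Y].  As [Fs] is also an involution,
one argument covers both halves of the structure. *)

Require Import Defs.
From HB Require Import structures.
From mathcomp Require Import all_boot all_order all_algebra.
From mathcomp Require Import all_classical all_reals all_analysis.

Set Implicit Arguments.
Unset Strict Implicit.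
Unset Printing Implicit Defensive.

Import Order.TTheory GRing.Theory Num.Theory.
Import numFieldNormedType.Exports.
Import Defs.

Local Open Scope classical_set_scope.
Local Open Scope ring_scope.

(** * Derivatives and maps of class C^k *)

Section Germs.
Variables (R : realType) (V W : normedModType R).
Implicit Types (f g : V -> W) (x : V).

(** The first-order expansion of [f] at [x] is also one of [g], because the two remainders agree
    near 0; uniqueness of the differential then yields differentiability and the value together. *)
Lemma near_eq_is_diff f g x :
  (\forall y \near x, f y = g y) -> differentiable f x ->
  is_diff x g ('d f x).
Proof.
move=> fg df.
have fgx : f x = g x by exact: nbhs_singleton fg.
have dfc := diff_continuous df.
have E : g \o shift x = cst (g x) + 'd f x +o_ 0 id.
  apply/eqaddoP => _/posnumP[e].
  have /eqaddoP/(_ _ (gt0 e)) h := diff_locally df.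
  have {}fg : \forall y \near 0, f (y + x) = g (y + x).
    move: fg; rewrite (near_shift 0 x).
    by apply: filterS => y /=; rewrite subr0.
  near=> y.
  have -> : (g \o shift x - (cst (g x) + 'd f x)) y =
            (f \o shift x - (cst (f x) + 'd f x)) y.
    rewrite !fctE /= fgx; congr (_ - _); apply/esym; near: y; exact: fg.
  by near: y; exact: h.
have dg : 'd g x = 'd f x :> (V -> W) by exact: diff_unique.
apply: DiffDef => //; apply/diff_locallyP; rewrite dg; split => //.
Unshelve. all: by end_near. Qed.

Lemma near_eq_differentiable f g x :
  (\forall y \near x, f y = g y) -> differentiable f x -> differentiable g x.
Proof. by move=> fg df; have [] := near_eq_is_diff fg df. Qed.

Lemma near_eq_diff f g x v :
  (\forall y \near x, f y = g y) -> differentiable f x -> 'd g x v = 'd f x v.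
Proof. by move=> fg df; have [_ ->] := near_eq_is_diff fg df. Qed.

End Germs.

Section Scaling.
Variables (R : realType) (V : normedModType R).

Lemma is_diff_scale (W : normedModType R) (k : V -> R^o) (g : V -> W) x :
  differentiable k x -> differentiable g x ->
  is_diff x (fun y => k y *: g y) (fun v => k x *: 'd g x v + 'd k x v *: g x).
Proof.
move=> dk dg.
have sbil : bilinear_for
    (GRing.Scale.Law.clone _ _ *:%R _) (GRing.Scale.Law.clone _ _ *:%R _)
    (fun (a : R^o) (w : W) => a *: w).
  split=> [u'|u] a y z /=; first by rewrite scalerDl scalerA.
  by rewrite scalerDr !scalerA mulrC.
(* Packaging scaling as a continuous bilinear map turns the Leibniz rule into the chain rule for
   this map after [y |-> (k y, g y)]. *)
pose sb := bilinear_isBilinear.Build R R^o W W _ _ _ sbil.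
pose sB : {bilinear R^o -> W -> W} :=
  HB.pack (fun (a : R^o) (w : W) => a *: w) sb.
have sc : continuous (fun p : R^o * W => sB p.1 p.2).
  by move=> p; exact: scale_continuous.
have -> : (fun y => k y *: g y) =
  (fun p => sB p.1 p.2) \o (fun y => (k y, g y)) by [].
have dp : differentiable (fun y => (k y, g y)) x by exact: differentiable_pair.
have db := differentiable_bilin (k x, g x) sc.
apply: DiffDef; first exact: differentiable_comp.
by rewrite diff_comp // diff_bilin // diff_pair.
Qed.

End Scaling.

Section ClassC.
Variables (R : realType) (V : normedModType R).
Implicit Types (W : normedModType R) (U : set V).

Lemma class_C_sub W k U U' (f : V -> W) :
  U' `<=` U -> class_C k U f -> class_C k U' f.
Proof.
move=> sU; elim: k f => /= [|k IH] f; first by move=> h x /sU; exact: h.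
by move=> [h1 h2]; split=> [x /sU|v]; [exact: h1|exact: IH].
Qed.

Lemma class_CS W k U (f : V -> W) : class_C k.+1 U f -> class_C k U f.
Proof.
elim: k f => [|k IH] f [h1 h2].
  by move=> x Ux; apply: differentiable_continuous; exact: h1.
by split => // v; apply: IH.
Qed.

(** Since [U] is open, equality on [U] is equality of germs at each of its points, which is what
    differentials see. *)
Lemma class_C_eq W k U (f g : V -> W) : open U ->
  (forall x, U x -> f x = g x) -> class_C k U f -> class_C k U g.
Proof.
move=> oU; elim: k f g => [|k IH] f g fg.
  move=> h x Ux; have fgx : \forall y \near x, f y = g y.
    by apply: filterS (open_nbhs_nbhs (conj oU Ux)).
  have hx : f @ x --> f x := h x Ux.
  suff : g @ x --> g x by [].
  by rewrite -(fg x Ux); apply: cvg_trans hx; exact: near_eq_cvg.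
move=> [h1 h2].
have near_fg x : U x -> \forall y \near x, f y = g y.
  by move=> Ux; apply: filterS (open_nbhs_nbhs (conj oU Ux)).
split=> [x Ux|v].
  by apply: near_eq_differentiable (h1 x Ux); exact: near_fg.
apply: IH (h2 v) => x Ux; apply/esym/near_eq_diff; first exact: near_fg.
exact: h1.
Qed.

(** [class_C] imposes conditions point by point on differentials of the total map, so it can be
    checked on any cover of [U]. *)
Lemma class_C_local W k U (f : V -> W) :
  (forall x, U x -> exists2 U', U' x & class_C k U' f) -> class_C k U f.
Proof.
elim: k f => [|k IH] f h /=.
  by move=> x /h[U' U'x c]; exact: c.
split=> [x Ux|v].
  by have [U' U'x [d _]] := h x Ux; exact: d.
apply: IH => x /h[U' U'x [_ h']]; exists U' => //; exact: h'.
Qed.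

Lemma class_C_cst W k U (a : W) : open U -> class_C k U (cst a).
Proof.
move=> oU; elim: k a => [|k IH] a; first by move=> x _; exact: cst_continuous.
split=> [x _|v]; first exact: differentiable_cst.
by apply: class_C_eq (IH 0) => // x _; rewrite diff_cst.
Qed.

Lemma class_C_linear W W' k U (L : {linear W -> W'}) (f : V -> W) : open U ->
  continuous L -> class_C k U f -> class_C k U (L \o f).
Proof.
move=> oU cL; elim: k f => [|k IH] f.
  by move=> h x Ux; apply: continuous_comp; [exact: h|exact: cL].
have dL y : differentiable L y by exact: linear_differentiable.
move=> [h1 h2]; split=> [x Ux|v]; first exact: differentiable_comp (h1 x Ux) _.
apply: class_C_eq (IH _ (h2 v)) => // x Ux /=.
by rewrite (diff_comp (h1 x Ux) (dL _)) /= (diff_lin _ cL).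
Qed.

Lemma class_CD W k U (f g : V -> W) : open U ->
  class_C k U f -> class_C k U g -> class_C k U (fun x => f x + g x).
Proof.
move=> oU; elim: k f g => [|k IH] f g.
  by move=> hf hg x Ux; apply: cvgD; [exact: hf|exact: hg].
move=> [f1 f2] [g1 g2]; split=> [x Ux|v].
  exact: differentiableD (f1 x Ux) (g1 x Ux).
apply: class_C_eq (IH _ _ (f2 v) (g2 v)) => // x Ux.
exact/esym/(congr1 (@^~ v) (diffD (f1 x Ux) (g1 x Ux))).
Qed.

Lemma class_C_sum W k U (I : Type) (r : seq I) (P : pred I) (f : I -> V -> W) :
  open U -> (forall i, P i -> class_C k U (f i)) ->
  class_C k U (fun x => \sum_(i <- r | P i) f i x).
Proof.
move=> oU hf; elim: r => [|i r IH].
  by apply: class_C_eq (class_C_cst k 0 oU) => // x _; rewrite big_nil.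
have [Pi|nPi] := boolP (P i).
  apply: class_C_eq (class_CD oU (hf i Pi) IH) => // x _.
  by rewrite big_cons Pi.
by apply: class_C_eq IH => // x _; rewrite big_cons (negbTE nPi).
Qed.

(** By the Leibniz rule the derivative is a sum of two products of the same kind; the
    undifferentiated factors are lowered by [class_CS] so that the induction closes. *)
Lemma class_C_scale W k U (a : V -> R^o) (f : V -> W) : open U ->
  class_C k U a -> class_C k U f -> class_C k U (fun x => a x *: f x).
Proof.
move=> oU; elim: k a f => [|k IH] a f.
  by move=> ha hf x Ux; apply: cvgZ; [exact: ha|exact: hf].
move=> ha hf; have [[a1 a2] [f1 f2]] := (ha, hf); split=> [x Ux|v].
  by have [] := is_diff_scale (a1 x Ux) (f1 x Ux).
have hD := class_CD oU (IH _ _ (class_CS ha) (f2 v))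
  (IH _ _ (a2 v) (class_CS hf)).
apply: class_C_eq hD => // x Ux /=.
have ds := is_diff_scale (a1 x Ux) (f1 x Ux).
exact/esym/(congr1 (@^~ v) (diff_val (is_diff_def := ds))).
Qed.

(** The derivative of [1/a] is [-(1/a)^2] times that of [a], a product of maps already known to be
    of class C^k. *)
Lemma class_C_inv k U (a : V -> R^o) : open U -> (forall x, U x -> a x != 0) ->
  class_C k U a -> class_C k U (fun x => (a x)^-1 : R^o).
Proof.
move=> oU a0; elim: k => [|k IH] ha.
  by move=> x Ux; apply: cvgV; [exact: a0|exact: ha].
have [a1 a2] := ha; have hi := IH (class_CS ha).
split=> [x Ux|v]; first by apply: differentiableV; [exact: a1|exact: a0].
have hii := class_C_scale oU (class_C_scale oU hi hi) (a2 v).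
have h := class_C_scale oU (class_C_cst k (-1 : R^o) oU) hii.
apply: class_C_eq h => // x Ux.
apply/esym/(etrans (congr1 (@^~ v) (diffV (a1 x Ux) (a0 x Ux)))).
by rewrite /= scaleN1r scaleNr -exprVn expr2.
Qed.

Lemma class_C_coord m n k U (f : V -> 'M[R]_(m, n)) i j : open U ->
  class_C k U f -> class_C k U (fun x => f x i j : R^o).
Proof.
move=> oU.
have lin : linear (fun A : 'M[R]_(m, n) => A i j : R^o).
  by move=> a A B; rewrite !mxE.
pose linM := GRing.isLinear.Build _ _ _ _ _ lin.
pose L : {linear 'M[R]_(m, n) -> R^o} :=
  HB.pack (fun A : 'M[R]_(m, n) => A i j : R^o) linM.
by apply: (@class_C_linear _ _ k U L) => //; exact: coord_continuous.
Qed.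

(** In the chain rule ['d g] is applied to the vector ['d f x v], which moves with [x], while
    [class_C] speaks of fixed directions. Expanding that vector in the standard basis of R^n leaves
    only the fixed directions [delta_mx 0 j]. *)
Lemma class_C_comp n W k U (U' : set 'rV[R]_n) (f : V -> 'rV[R]_n)
    (g : 'rV[R]_n -> W) : open U -> (forall x, U x -> U' (f x)) ->
  class_C k U f -> class_C k U' g -> class_C k U (g \o f).
Proof.
move=> oU UU'; elim: k f g UU' => [|k IH] f g UU'.
  by move=> hf hg x Ux; apply: continuous_comp; [exact: hf|exact/hg/UU'].
move=> hf hg; have [[f1 f2] [g1 g2]] := (hf, hg); split=> [x Ux|v].
  by apply: differentiable_comp; [exact: f1|exact/g1/UU'].
have h j : class_C k U (fun x => ('d f x v) 0 j *: 'd g (f x) (delta_mx 0 j)).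
  apply: class_C_scale => //; last exact: IH (UU') (class_CS hf) (g2 _).
  exact: class_C_coord (f2 v).
have hs := class_C_sum (index_enum _) oU (fun j (_ : predT j) => h j).
apply: class_C_eq hs => // x Ux.
have dgf := diff_comp (f1 x Ux) (g1 _ (UU' x Ux)).
apply/esym/(etrans (congr1 (@^~ v) dgf)) => /=.
rewrite [in LHS](row_sum_delta ('d f x v)) linear_sum.
by apply: eq_bigr => j _; rewrite linearZ.
Qed.

End ClassC.

(** * Smooth maps *)

Section Smooth.
Variables (R : realType) (V : normedModType R).
Implicit Types (W : normedModType R) (U : set V).

Lemma smooth_sub W U U' (f : V -> W) :
  U' `<=` U -> smooth_on U f -> smooth_on U' f.
Proof. by move=> sU h k; exact: class_C_sub (h k). Qed.

Lemma smooth_eq W U (f g : V -> W) : open U ->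
  (forall x, U x -> f x = g x) -> smooth_on U f -> smooth_on U g.
Proof. by move=> oU fg h k; exact: class_C_eq (h k). Qed.

Lemma smooth_local W U (f : V -> W) :
  (forall x, U x -> exists2 U', U' x & smooth_on U' f) -> smooth_on U f.
Proof.
move=> h k; apply: class_C_local => x /h[U' U'x c]; exists U' => //; exact: c.
Qed.

Lemma smooth_differentiable W U (f : V -> W) x :
  smooth_on U f -> U x -> differentiable f x.
Proof. by move=> /(_ 1)[h _]; exact: h. Qed.

Lemma smooth_diff W U (f : V -> W) v :
  smooth_on U f -> smooth_on U (fun x => 'd f x v).
Proof. by move=> h k; have [_ h'] := h k.+1; exact: h'. Qed.

Lemma smooth_cst W U (a : W) : open U -> smooth_on U (cst a).
Proof. by move=> oU k; exact: class_C_cst. Qed.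

Lemma smooth_sum W U (I : Type) (r : seq I) (P : pred I) (f : I -> V -> W) :
  open U -> (forall i, P i -> smooth_on U (f i)) ->
  smooth_on U (fun x => \sum_(i <- r | P i) f i x).
Proof. by move=> oU h k; apply: class_C_sum => // i Pi; exact: h. Qed.

Lemma smooth_scale W U (a : V -> R^o) (f : V -> W) : open U ->
  smooth_on U a -> smooth_on U f -> smooth_on U (fun x => a x *: f x).
Proof. by move=> oU ha hf k; exact: class_C_scale. Qed.

Lemma smoothM U (a b : V -> R^o) : open U ->
  smooth_on U a -> smooth_on U b -> smooth_on U (fun x => a x * b x : R^o).
Proof. exact: smooth_scale. Qed.

Lemma smooth_prod U (I : Type) (r : seq I) (P : pred I) (a : I -> V -> R^o) :
  open U -> (forall i, P i -> smooth_on U (a i)) ->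
  smooth_on U (fun x => \prod_(i <- r | P i) a i x : R^o).
Proof.
move=> oU h; elim: r => [|i r IH].
  by apply: smooth_eq (smooth_cst (1 : R^o) oU) => // x _; rewrite big_nil.
have [Pi|nPi] := boolP (P i).
  by apply: smooth_eq (smoothM oU (h i Pi) IH) => // x _; rewrite big_cons Pi.
by apply: smooth_eq IH => // x _; rewrite big_cons (negbTE nPi).
Qed.

Lemma smooth_inv U (a : V -> R^o) : open U -> (forall x, U x -> a x != 0) ->
  smooth_on U a -> smooth_on U (fun x => (a x)^-1 : R^o).
Proof. by move=> oU a0 h k; exact: class_C_inv. Qed.

Lemma smooth_comp n W U (U' : set 'rV[R]_n) (f : V -> 'rV[R]_n)
    (g : 'rV[R]_n -> W) : open U -> (forall x, U x -> U' (f x)) ->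
  smooth_on U f -> smooth_on U' g -> smooth_on U (fun x => g (f x)).
Proof. by move=> oU UU' hf hg k; exact: class_C_comp (hf k) (hg k). Qed.

Lemma smooth_coord m n U (f : V -> 'M[R]_(m, n)) i j : open U ->
  smooth_on U f -> smooth_on U (fun x => f x i j : R^o).
Proof. by move=> oU h k; exact: class_C_coord. Qed.

Lemma smooth_row n U (f : V -> 'rV[R]_n) : open U ->
  (forall j, smooth_on U (fun x => f x 0 j : R^o)) -> smooth_on U f.
Proof.
move=> oU h.
have hs : smooth_on U (fun x => \sum_j f x 0 j *: delta_mx 0 j : 'rV[R]_n).
  apply: smooth_sum => // j _.
  by apply: smooth_scale => //; exact: smooth_cst.
by apply: smooth_eq hs => // x _; rewrite -row_sum_delta.
Qed.

Lemma smooth_det n U (A : V -> 'M[R]_n) : open U ->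
  (forall i j, smooth_on U (fun x => A x i j : R^o)) ->
  smooth_on U (fun x => \det (A x) : R^o).
Proof.
move=> oU hA; apply: smooth_sum => // s _.
apply: smoothM => //; first exact: smooth_cst.
by apply: smooth_prod.
Qed.

(** By Cramer's rule the entries are cofactors divided by the determinant. *)
Lemma smooth_invmx n U (A : V -> 'M[R]_n) i j : open U ->
  (forall x, U x -> A x \in unitmx) ->
  (forall i j, smooth_on U (fun x => A x i j : R^o)) ->
  smooth_on U (fun x => invmx (A x) i j : R^o).
Proof.
move=> oU uA hA.
have h : smooth_on U (fun x => (\det (A x))^-1 * cofactor (A x) j i : R^o).
  apply: smoothM => //; first apply: smooth_inv => //.
  - by move=> x /uA; rewrite unitmxE unitfE.
  - exact: smooth_det.
  apply: smoothM => //; first exact: smooth_cst.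
  apply: smooth_det => // i' j'.
  by apply: smooth_eq (hA (lift j i') (lift i j')) => // x _; rewrite !mxE.
by apply: smooth_eq h => // x Ux; rewrite /invmx uA // !mxE.
Qed.

End Smooth.

(** * Charts and differentials *)

(** Charts are total maps with junk values outside their domains, so identities such as
    [cinv c (c p) = p] hold only locally; this is the chain rule for a composite known only near
    [x]. *)
Lemma diff_comp_near (R : realType) (V V' W : normedModType R)
    (f : V -> V') (g : V' -> W) (h : V -> W) x v :
  (\forall y \near x, g (f y) = h y) ->
  differentiable f x -> differentiable g (f x) ->
  'd g (f x) ('d f x v) = 'd h x v.
Proof.
move=> gfh df dg; have dgf := differentiable_comp df dg.
rewrite -[LHS](congr1 (@^~ v) (diff_comp df dg)).
by apply/esym/near_eq_diff.
Qed.

(** The domain of the local representative [d \o f \o cinv c], written exactly as the set in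
    [is_smooth_map] and [is_vector_field_along]. *)
Definition chart_dom (R : realType) (m n : nat) (M : manifold R m)
    (N : manifold R n) (f : M -> N) (c : chart R m M) (d : chart R n N) :
    set 'rV[R]_m :=
  ctgt c `&` (f \o cinv c) @^-1` csrc d.
Arguments chart_dom {R m n M N} f c d _.

Section LocalRepresentatives.
Variables (R : realType) (m n : nat) (M : manifold R m) (N : manifold R n).
Variable (f : M -> N).
Hypothesis fsm : is_smooth_map f.
Implicit Types (c : chart R m M) (d : chart R n N) (p : M).

Lemma chart_domP c d p : csrc c p -> csrc d (f p) -> chart_dom f c d (c p).
Proof.
by move=> cp dp; split; [exact: cfun_tgt|rewrite /preimage /= cfunK].
Qed.

(** Continuity of [cinv c] is available only at points of [ctgt c], so each point is shown to be
    interior. *)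
Lemma open_chart_dom c d : open (chart_dom f c d).
Proof.
rewrite openE => x [cx dx]; apply: filterI.
  exact: open_nbhs_nbhs (conj (@ctgt_open _ _ _ c) cx).
have fc : {for x, continuous (f \o cinv c)}.
  by apply: continuous_comp; [exact: cinv_cont|exact: (proj1 fsm)].
exact: (fc _ (open_nbhs_nbhs (conj (@csrc_open _ _ _ d) dx))).
Qed.

Lemma smooth_local_repr c d : atlas c -> atlas d ->
  smooth_on (chart_dom f c d) (d \o f \o cinv c).
Proof. by move=> hc hd; exact: (proj2 fsm). Qed.

Lemma near_chart_dom c d p : csrc c p -> csrc d (f p) ->
  \forall x \near c p, chart_dom f c d x.
Proof.
move=> cp dp; apply: open_nbhs_nbhs; split; first exact: open_chart_dom.
exact: chart_domP.
Qed.

Lemma local_repr_differentiable c d p : atlas c -> atlas d ->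
  csrc c p -> csrc d (f p) -> differentiable (d \o f \o cinv c) (c p).
Proof.
move=> hc hd cp dp; apply: smooth_differentiable (smooth_local_repr hc hd) _.
exact: chart_domP.
Qed.

(** Inserting [cinv d \o d] after [f] writes the map as [K \o cinv d] composed with the local
    representative of [f]. *)
Lemma smooth_pullback (W : normedModType R) c d (K : N -> W) :
  atlas c -> atlas d -> smooth_on (ctgt d) (K \o cinv d) ->
  smooth_on (chart_dom f c d) (fun x => K (f (cinv c x))).
Proof.
move=> hc hd hK; have o : open (chart_dom f c d) by exact: open_chart_dom.
have h := smooth_comp o _ (smooth_local_repr hc hd) hK.
apply: smooth_eq (h _) => // x [cx dx] /=; first by rewrite cfunK.
exact: cfun_tgt.
Qed.

End LocalRepresentatives.

(** Transition maps thereby become local representatives of the identity, so facts about smooth maps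
    also cover changes of charts. *)
Lemma id_smooth_map (R : realType) n (M : manifold R n) :
  is_smooth_map (id : M -> M).
Proof. split=> [p|c d hc hd]; [exact: cvg_id|exact (atlas_compat hc hd)]. Qed.

Section ChangeOfCharts.
Variables (R : realType) (m n : nat) (M : manifold R m) (N : manifold R n).
Variable (f : M -> N).
Hypothesis fsm : is_smooth_map f.
Implicit Types (c : chart R m M) (d : chart R n N) (p : M).

(** Chain rule for a change of chart in the target; with [f] the identity it is the cocycle rule for
    transition maps. *)
Lemma diff_local_repr_tgt c d d' p v : atlas c -> atlas d -> atlas d' ->
  csrc c p -> csrc d (f p) -> csrc d' (f p) ->
  'd (d' \o cinv d) (d (f p)) ('d (d \o f \o cinv c) (c p) v) =
  'd (d' \o f \o cinv c) (c p) v.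
Proof.
move=> hc hd hd' cp dp d'p.
have E : d (f p) = (d \o f \o cinv c) (c p) by rewrite /= cfunK.
rewrite E; apply: diff_comp_near.
- near=> x; rewrite /= cfunK //.
  by have [] : chart_dom f c d x by near: x; exact: near_chart_dom.
- exact: local_repr_differentiable.
- rewrite -E; exact: (local_repr_differentiable (@id_smooth_map _ _ N)).
Unshelve. all: by end_near. Qed.

Lemma diff_local_repr_src c c' d p v : atlas c -> atlas c' -> atlas d ->
  csrc c p -> csrc c' p -> csrc d (f p) ->
  'd (d \o f \o cinv c') (c' p) ('d (c' \o cinv c) (c p) v) =
  'd (d \o f \o cinv c) (c p) v.
Proof.
move=> hc hc' hd cp c'p dp.
have E : c' p = (c' \o cinv c) (c p) by rewrite /= cfunK.
rewrite E; apply: diff_comp_near.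
- near=> x; rewrite /= cfunK //.
  have [] // : chart_dom id c c' x.
  by near: x; apply: near_chart_dom => //; exact: id_smooth_map.
- exact: (local_repr_differentiable (@id_smooth_map _ _ M)).
- by rewrite -E; exact: local_repr_differentiable.
Unshelve. all: by end_near. Qed.

End ChangeOfCharts.

Section Coordinates.
Variables (R : realType) (n : nat) (M : manifold R n).
Implicit Types (c d : chart R n M) (p : M).

Lemma diff_chart_id c p v : csrc c p -> 'd (c \o cinv c) (c p) v = v.
Proof.
move=> cp.
have -> : 'd (c \o cinv c) (c p) v = 'd (id : 'rV[R]_n -> _) (c p) v.
  apply: near_eq_diff => //.
  have nc := open_nbhs_nbhs (conj (@ctgt_open _ _ _ c) (cfun_tgt cp)).
  apply: filterS nc => y cy.
  by rewrite /= cinvK.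
by rewrite diff_val.
Qed.

(** By the cocycle rule, passing from [c] to the preferred chart and back is the differential of
    [c \o cinv c], which is the identity near [c p]. *)
Lemma frameK c p u : atlas c -> csrc c p -> coord c (frame c p u) = u.
Proof.
move=> hc cp; have hp := chart_at_atlas p; have sp := chart_at_src p.
rewrite /coord /frame.
rewrite (diff_local_repr_tgt (@id_smooth_map _ _ M) u hc hp hc cp sp cp).
exact: diff_chart_id.
Qed.

Lemma coordK c p (v : tangent p) : atlas c -> csrc c p ->
  frame c p (coord c v) = v.
Proof.
move=> hc cp; have hp := chart_at_atlas p; have sp := chart_at_src p.
rewrite /coord /frame.
rewrite (diff_local_repr_tgt (@id_smooth_map _ _ M) v hp hc hp sp cp sp).
exact: diff_chart_id.
Qed.

Lemma coord_is_linear c p : linear (@coord _ _ _ c p).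
Proof. by move=> a u v; rewrite /coord linearP. Qed.

Lemma frame_is_linear c p : linear (@frame _ _ _ c p).
Proof. by move=> a u v; rewrite /frame linearP. Qed.

End Coordinates.

Section Differential.
Variables (R : realType) (m n : nat) (M : manifold R m) (N : manifold R n).
Variable (f : M -> N).
Hypothesis fsm : is_smooth_map f.
Implicit Types (c : chart R m M) (d : chart R n N) (p : M).

Lemma differential_is_linear p : linear (@differential _ _ _ _ _ f p).
Proof. by move=> a u v; rewrite /differential linearP. Qed.

(** [differential] is defined in the preferred charts at [p] and [f p]; the chain rule trades both
    for [c] and [d]. As preferred charts may jump from point to point, smoothness can be read off
    only after this exchange. *)
Lemma coord_differential c d p u : atlas c -> atlas d ->
  csrc c p -> csrc d (f p) ->
  coord d (differential f (frame c p u)) =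
  'd (d \o f \o cinv c) (c p) u.
Proof.
move=> hc hd cp dp.
have hp := chart_at_atlas p; have sp := chart_at_src p.
have hfp := chart_at_atlas (f p); have sfp := chart_at_src (f p).
rewrite /coord /frame /differential.
rewrite (diff_local_repr_tgt fsm _ hp hfp hd sp sfp dp).
exact: diff_local_repr_src.
Qed.

Lemma smooth_coord_differential c d u : atlas c -> atlas d ->
  smooth_on (chart_dom f c d)
    (fun x => coord d (differential f (frame c (cinv c x) u))).
Proof.
move=> hc hd; have o : open (chart_dom f c d) by exact: open_chart_dom.
apply: smooth_eq (smooth_diff u (smooth_local_repr fsm hc hd)) => // x [cx dx].
by rewrite (coord_differential _ hc hd (cinv_src cx) dx) cinvK.
Qed.

End Differential.

(** * Tensor fields in charts *)

(** Stated for the predicate [linear], the form in which tensor fields provide their linearity. *)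
Lemma linear_sumZ (R : realType) (V W : lmodType R) (L : V -> W) (I : Type)
    (r : seq I) (a : I -> R) (v : I -> V) : linear L ->
  L (\sum_(i <- r) a i *: v i) = \sum_(i <- r) a i *: L (v i).
Proof.
move=> hL.
have L0 : L 0 = 0 by have := hL (-1) 0 0; rewrite scaler0 addr0 scaleN1r addNr.
elim: r => [|i r IH]; first by rewrite !big_nil.
by rewrite !big_cons hL IH.
Qed.

Lemma scalar_sumZ (R : realType) (V : lmodType R) (L : V -> R) (I : Type)
    (r : seq I) (a : I -> R) (v : I -> V) : scalar L ->
  L (\sum_(i <- r) a i *: v i) = \sum_(i <- r) a i * L (v i).
Proof. exact: (@linear_sumZ R V R^o). Qed.

Section Metric.
Variables (R : realType) (n : nat) (M : manifold R n).
Implicit Types (c : chart R n M) (p : M).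

Lemma frame_expansion c p (v : tangent p) : atlas c -> csrc c p ->
  v = \sum_j (coord c v) 0 j *: frame c p (delta_mx 0 j).
Proof.
move=> hc cp; rewrite -{1}(coordK v hc cp) {1}(row_sum_delta (coord c v)).
by rewrite (linear_sumZ _ _ _ (frame_is_linear _ _)).
Qed.

Variable g : forall p : M, tangent p -> tangent p -> R.
Hypothesis hg : is_riemannian g.

Lemma metricC p (X Y : tangent p) : g X Y = g Y X.
Proof. by have [_ h _ _] := hg; exact: h. Qed.

Lemma metricPr p (X : tangent p) : scalar (g X).
Proof. by have [h _ _ _] := hg; exact: h. Qed.

Lemma metricPl p (Y : tangent p) : scalar (fun X => g X Y).
Proof. by move=> a u v; rewrite !(metricC _ Y) metricPr. Qed.

Lemma metric_eq0 p (X : tangent p) : g X X = 0 -> X = 0.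
Proof.
have [_ _ h _] := hg; move=> gX; apply/eqP; apply: contraT => /h.
by rewrite gX ltxx.
Qed.

(** With [G] the Gram matrix of the frame and [b] the row of products of [X] with it, the
    coordinates of [X] are [b *m invmx G], whose entries are smooth. This recovers a field known
    only through its inner products. *)
Lemma smooth_coord_metric c (U : set 'rV[R]_n) (X : forall p : M, tangent p) :
  atlas c -> open U -> U `<=` ctgt c ->
  (forall u, smooth_on U (fun x => g (X (cinv c x)) (frame c _ u) : R^o)) ->
  smooth_on U (fun x => coord c (X (cinv c x))).
Proof.
move=> hc oU Uc hX.
pose e (j : 'I_n) : 'rV[R]_n := delta_mx 0 j.
pose G x := \matrix_(i, j) g (frame c (cinv c x) (e i)) (frame c _ (e j)).
pose b x := \row_j g (X (cinv c x)) (frame c _ (e j)).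
have GE x (v : tangent (cinv c x)) : U x ->
    coord c v *m G x = \row_j g v (frame c _ (e j)).
  move=> /Uc cx; apply/rowP => j; rewrite !mxE.
  rewrite [in RHS](frame_expansion v hc (cinv_src cx)).
  rewrite (scalar_sumZ _ _ _ (metricPl _)).
  by apply: eq_bigr => i _; rewrite mxE.
(* A row vector killed by [G x] represents a tangent vector orthogonal to the whole frame, hence to
   itself, hence zero. *)
have uG x : U x -> G x \in unitmx.
  move=> Ux; have cx := cinv_src (Uc x Ux); rewrite -row_free_unit -kermx_eq0.
  apply/rowV0P => u /sub_kermxP uG0.
  have uE : u = coord c (frame c (cinv c x) u) by rewrite frameK.
  suff f0 : frame c (cinv c x) u = 0 by rewrite uE f0 /coord linear0.
  apply: metric_eq0; rewrite {2}(frame_expansion (frame c _ u) hc cx).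
  rewrite (scalar_sumZ _ _ _ (metricPr _)) big1 // => j _.
  have := congr1 (fun A : 'rV_n => A 0 j) uG0.
  by rewrite {1}uE GE // !mxE => ->; rewrite mulr0.
have sG i j : smooth_on U (fun x => G x i j : R^o).
  have [_ _ _ h] := hg.
  apply: smooth_eq (smooth_sub Uc (h c hc (e i) (e j))) => // x _.
  by rewrite mxE.
apply: smooth_row => // j.
have h : smooth_on U (fun x => \sum_i b x 0 i * invmx (G x) i j : R^o).
  apply: smooth_sum => // i _; apply: smoothM => //; last exact: smooth_invmx.
  by apply: smooth_eq (hX (e i)) => // x _; rewrite mxE.
apply: smooth_eq h => // x Ux.
by rewrite -[coord c _](mulmxK (uG x Ux)) GE // [RHS]mxE.
Qed.

End Metric.

Section AlongMap.
Variables (R : realType) (m n : nat) (M : manifold R m) (N : manifold R n).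
Variable (f : M -> N).
Hypothesis fsm : is_smooth_map f.
Variable c : chart R m M.
Hypothesis hc : atlas c.
Implicit Types (X Y : forall p, tangent (f p)).

(** The source chart [c] is fixed because the main examples,
    [fun p => differential f (frame c p u)], are built from it. *)
Definition smooth_along X :=
  forall d, atlas d ->
    smooth_on (chart_dom f c d) (fun x => coord d (X (cinv c x))).

Lemma smooth_along_differential u :
  smooth_along (fun p => differential f (frame c p u)).
Proof. by move=> d hd; exact: smooth_coord_differential. Qed.

(** In a target chart, the coordinates of [F X] are combinations of the components of [F] pulled
    back by [f], with the coordinates of [X] as coefficients. *)
Lemma smooth_along_tensor (F : forall q : N, tangent q -> tangent q) X :
  is_tensor11 F -> smooth_along X -> smooth_along (fun p => F _ (X p)).
Proof.
move=> [Flin Fsm] hX d hd.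
have o : open (chart_dom f c d) by exact: open_chart_dom.
pose e (j : 'I_n) : 'rV[R]_n := delta_mx 0 j.
pose K (u : 'rV[R]_n) (q : N) := coord d (F q (frame d q u)).
have h : smooth_on (chart_dom f c d) (fun x =>
    \sum_j (coord d (X (cinv c x))) 0 j *: K (e j) (f (cinv c x))).
  apply: smooth_sum => // j _; apply: smooth_scale => //.
    by apply: smooth_coord => //; exact: hX.
  by apply: smooth_pullback => //; exact: Fsm.
apply: smooth_eq h => // x [cx dx].
rewrite [X in F _ X](frame_expansion (X (cinv c x)) hd dx).
rewrite (linear_sumZ _ _ _ (Flin _)).
by rewrite (linear_sumZ _ _ _ (@coord_is_linear _ _ _ d _)).
Qed.

(** The function is scalar, so its smoothness is a local matter: the sets [chart_dom f c d] cover
    [ctgt c], and on each one the product expands bilinearly in the frame of [d]. *)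
Lemma smooth_along_metric (g : forall q : N, tangent q -> tangent q -> R) X Y :
  is_riemannian g -> smooth_along X -> smooth_along Y ->
  smooth_on (ctgt c) (fun x => g _ (X (cinv c x)) (Y (cinv c x)) : R^o).
Proof.
move=> hg hX hY; apply: smooth_local => x cx.
pose d := chart_at (f (cinv c x)).
have hd : atlas d by exact: chart_at_atlas.
exists (chart_dom f c d); first by split => //; exact: chart_at_src.
have o : open (chart_dom f c d) by exact: open_chart_dom.
pose e (j : 'I_n) : 'rV[R]_n := delta_mx 0 j.
pose K (u v : 'rV[R]_n) (q : N) : R^o := g q (frame d q u) (frame d q v).
have h : smooth_on (chart_dom f c d) (fun y =>
    \sum_i (coord d (X (cinv c y))) 0 i *
    \sum_j (coord d (Y (cinv c y))) 0 j * K (e i) (e j) (f (cinv c y)) : R^o).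
  apply: smooth_sum => // i _; apply: smoothM => //.
    by apply: smooth_coord => //; exact: hX.
  apply: smooth_sum => // j _; apply: smoothM => //.
    by apply: smooth_coord => //; exact: hY.
  by apply: smooth_pullback => //; have [_ _ _] := hg; exact.
apply: smooth_eq h => // y [cy dy].
rewrite [X in g _ X _](frame_expansion (X (cinv c y)) hd dy).
rewrite [X in g _ _ X](frame_expansion (Y (cinv c y)) hd dy).
rewrite (scalar_sumZ _ _ _ (metricPl hg _)).
by apply: eq_bigr => i _; rewrite (scalar_sumZ _ _ _ (metricPr hg _)).
Qed.

End AlongMap.

(** * Tangential hypersurfaces *)

(* The image of [D] and the kernel of [b] both have dimension [n], and the
   former is contained in the latter. *)
Lemma form_eq0_image (R : realType) (n : nat)
    (V : lmodType R := 'rV[R]_n) (W : lmodType R := 'rV[R]_n.+1)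
    (D : V -> W) (b : W -> R) (w0 w : W) :
  linear D -> injective D -> scalar b -> b w0 != 0 ->
  (forall v, b (D v) = 0) -> b w = 0 -> exists v, D v = w.
Proof.
move=> Dlin Dinj blin bw0 bD bw.
pose A : 'M[R]_(n, n.+1) := \matrix_i D (delta_mx 0 i).
pose B : 'cV[R]_n.+1 := \col_i b (delta_mx 0 i).
have DE v : D v = v *m A.
  rewrite mulmx_sum_row {1}(row_sum_delta v) (linear_sumZ _ _ _ Dlin).
  by apply: eq_bigr => i _; rewrite rowK.
have bE v : b v = (v *m B) 0 0.
  rewrite !mxE {1}(row_sum_delta v) (scalar_sumZ _ _ _ blin).
  by apply: eq_bigr => i _; rewrite mxE.
have mulB0 v : b v = 0 -> v *m B = 0.
  by move=> bv; apply/rowP => j; rewrite ord1 -bE bv mxE.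
have D0 : D 0 = 0 by rewrite DE mul0mx.
have rA : \rank A = n.
  apply/eqP; rewrite -/(row_free A) -kermx_eq0; apply/rowV0P => v.
  by move=> /sub_kermxP vA; apply: Dinj; rewrite DE vA D0.
have B0 : B != 0.
  by apply: contraNneq bw0 => B0; rewrite bE B0 mulmx0 mxE.
have AB : (A <= kermx B)%MS.
  by apply/row_subP => i; apply/sub_kermxP/mulB0; rewrite rowK bD.
have rB : \rank (kermx B) = n.
  rewrite mxrank_ker; suff -> : \rank B = 1%N by rewrite subn1.
  by apply/eqP; rewrite eqn_leq rank_leq_col lt0n mxrank_eq0.
have /sub_kermxP wB := mulB0 w bw.
have : (w <= A)%MS.
  by apply: submx_trans wB _; rewrite -(mxrank_leqif_sup AB) rA rB.
by move=> /submxP[v ->]; exists v; rewrite DE.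
Qed.

Section TangentialHypersurface.
Variables (R : realType) (n : nat) (Mt : manifold R n.+1).
Variable gt : forall q : Mt, tangent q -> tangent q -> R.
Variables (M : manifold R n) (f : M -> Mt) (N : forall p : M, tangent (f p)).
Hypotheses (hgt : is_riemannian gt) (hM : is_hypersurface gt N).
Notation df := (@differential _ _ _ _ _ f _).

Lemma normal_unit p : gt (N p) (N p) = 1.
Proof. by have [_ _ h _] := hM; exact: h. Qed.

Lemma normal_orth p (X : tangent p) : gt (df X) (N p) = 0.
Proof. by have [_ _ _ h] := hM; exact: h. Qed.

Lemma normal_orthC p (X : tangent p) : gt (N p) (df X) = 0.
Proof. by rewrite metricC // normal_orth. Qed.

Lemma hypersurface_smooth : is_smooth_map f.
Proof. by have [[]] := hM. Qed.

Lemma df_inj p : injective (@differential _ _ _ _ _ f p).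
Proof. by have [[_ h] _ _ _] := hM; exact: h. Qed.

Lemma df0 p : @differential _ _ _ _ _ f p 0 = 0.
Proof. exact: linear0. Qed.

Lemma gtDl p (a : R) (X Y Z : tangent (f p)) :
  gt (X + a *: Y) Z = gt X Z + a * gt Y Z.
Proof. by rewrite addrC (metricPl hgt) addrC. Qed.

Lemma gt_normal p (X : tangent p) a : gt (df X + a *: N p) (N p) = a.
Proof. by rewrite gtDl normal_orth normal_unit mulr1 add0r. Qed.

Lemma gt_tangent p (X Y : tangent p) a :
  gt (df X + a *: N p) (df Y) = gt (df X) (df Y).
Proof. by rewrite gtDl normal_orthC mulr0 addr0. Qed.

(** For the images of [F] and [Fs], the term [a * b] becomes the correction [etas X * eta Y] in the
    metric identity. *)
Lemma gt_tangent_normal p (X Y : tangent p) a b :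
  gt (df X + a *: N p) (df Y + b *: N p) = gt (df X) (df Y) + a * b.
Proof.
by rewrite [df Y + _]addrC (metricPr hgt) gt_normal gt_tangent addrC mulrC.
Qed.

(** Pairing with [N] isolates the normal coefficient, and injectivity of the differential does the
    rest. Every comparison of tangential and normal parts below goes through this lemma. *)
Lemma tangent_normal_inj p (X Y : tangent p) a b :
  df X + a *: N p = df Y + b *: N p -> X = Y /\ a = b.
Proof.
move=> E; have ab : a = b by rewrite -(gt_normal X a) E gt_normal.
by split=> //; apply: df_inj; move: E; rewrite ab => /addIr.
Qed.

(** Subtracting the normal component of [w] leaves a vector in the kernel of [gt _ (N p)];
    codimension one makes that kernel the image of the differential. *)
Lemma tangent_normal_decomp p (w : tangent (f p)) :
  exists X : tangent p, w = df X + gt w (N p) *: N p.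
Proof.
have [||||||X E] := @form_eq0_image R n (@differential _ _ _ _ _ f p)
  (fun v => gt v (N p)) (N p) (w - gt w (N p) *: N p).
- exact: differential_is_linear.
- exact: df_inj.
- exact: metricPl.
- by rewrite normal_unit oner_neq0.
- exact: normal_orth.
- by rewrite -scaleNr gtDl normal_unit mulr1 subrr.
by exists X; rewrite E subrK.
Qed.

Let g : forall p : M, tangent p -> tangent p -> R := induced_metric gt f.

Lemma induced_metric_riemannian : is_riemannian g.
Proof.
have fsm := hypersurface_smooth.
split=> [p X a Y Z|p X Y|p X X0|c hc u v].
- by rewrite /g /induced_metric differential_is_linear (metricPr hgt).
- exact: (metricC hgt).
- have [_ _ h _] := hgt; apply: h; apply: contra X0 => /eqP X0.
  by apply/eqP/df_inj; rewrite X0 df0.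
exact: smooth_along_metric (smooth_along_differential fsm hc u)
  (smooth_along_differential fsm hc v).
Qed.

(** * Objects induced on the hypersurface by an involutive tensor field *)

Section InducedTensors.
(** For [T = F] the triple [psi], [zeta], [alpha] is [phi], [xi], [etas]; for [T = Fs] it is [phis],
    [xis], [eta]. *)
Variables (T : forall q : Mt, tangent q -> tangent q).
Hypotheses (hT : is_tensor11 T) (TT : forall q (X : tangent q), T (T X) = X).
Variables (psi : forall p : M, tangent p -> tangent p)
  (zeta : forall p : M, tangent p) (alpha : forall p : M, tangent p -> R).
Hypotheses (TN : forall p, T (N p) = df (zeta p))
  (Tdf : forall p (X : tangent p), T (df X) = df (psi X) + alpha X *: N p).

(** Nothing but the defining equations is assumed of [psi] and [alpha]; linearity follows from that
    of [T] and uniqueness of the decomposition. *)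
Lemma induced_linear p a (X Y : tangent p) :
  psi (a *: X + Y) = a *: psi X + psi Y /\
  alpha (a *: X + Y) = a * alpha X + alpha Y.
Proof.
apply: (@tangent_normal_inj p); rewrite -Tdf !differential_is_linear.
by rewrite (proj1 hT) !Tdf scalerDr scalerDl addrACA scalerA.
Qed.

(** Applying [T] to the decomposition of [T (df X)] must return [df X]; the two claims are its
    tangential and normal parts. *)
Lemma induced_sq p (X : tangent p) :
  psi (psi X) = X - alpha X *: zeta p /\ alpha (psi X) = 0.
Proof.
apply: (@tangent_normal_inj p); rewrite scale0r addr0.
have E : alpha X *: df (zeta p) +
    (df (psi (psi X)) + alpha (psi X) *: N p) = df X.
  by rewrite -TN -Tdf -(proj1 hT) addrC -Tdf TT.
have -> : X - alpha X *: zeta p = - alpha X *: zeta p + X.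
  by rewrite scaleNr addrC.
by rewrite differential_is_linear -E scaleNr addKr.
Qed.

(** These are the tangential and normal parts of [T (T N) = N]. *)
Lemma induced_vector p : psi (zeta p) = 0 /\ alpha (zeta p) = 1.
Proof.
apply: (@tangent_normal_inj p); rewrite -Tdf -TN TT scale1r.
by rewrite df0 add0r.
Qed.

Lemma smooth_along_normal c : atlas c -> smooth_along c N.
Proof. by move=> hc d hd; have [_ h _ _] := hM; exact: h. Qed.

Lemma induced_is_one_form : is_one_form alpha.
Proof.
split=> [p a X Y|c hc u]; first by have [] := induced_linear a X Y.
have fsm := hypersurface_smooth.
have h := smooth_along_metric fsm hc hgt
  (smooth_along_tensor fsm hc hT (smooth_along_differential fsm hc u))
  (smooth_along_normal hc).
by apply: smooth_eq h => [|x _]; [exact: ctgt_open|rewrite Tdf gt_normal].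
Qed.

Lemma induced_is_vector_field : is_vector_field zeta.
Proof.
move=> c hc; have fsm := hypersurface_smooth.
apply: (smooth_coord_metric induced_metric_riemannian) => // [|u].
  exact: ctgt_open.
have h := smooth_along_metric fsm hc hgt
  (smooth_along_tensor fsm hc hT (smooth_along_normal hc))
  (smooth_along_differential fsm hc u).
by apply: smooth_eq h => [|x _]; [exact: ctgt_open|rewrite TN].
Qed.

Lemma induced_is_tensor11 : is_tensor11 psi.
Proof.
split=> [p a X Y|c hc u]; first by have [] := induced_linear a X Y.
have fsm := hypersurface_smooth.
(* The section is given explicitly: it depends on the chart [c] and is meaningful only over its
   source. *)
apply: (smooth_coord_metric (X := fun p => psi (frame c p u))
  induced_metric_riemannian) => // [|v]; first exact: ctgt_open.
have h := smooth_along_metric fsm hc hgt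
  (smooth_along_tensor fsm hc hT (smooth_along_differential fsm hc u))
  (smooth_along_differential fsm hc v).
by apply: smooth_eq h => [|x _]; [exact: ctgt_open|rewrite Tdf gt_tangent].
Qed.

End InducedTensors.

End TangentialHypersurface.

Theorem corollary6p3 (R : realType) (n : nat)
  (Mt : manifold R n.+1)
  (gt : forall q : Mt, tangent q -> tangent q -> R)
  (F Fs : forall q : Mt, tangent q -> tangent q)
  (hMt : almost_product_like gt F Fs)
  (M : manifold R n) (f : M -> Mt) (N : forall p : M, tangent (f p))
  (hM : is_hypersurface gt N)
  (hT : is_tangential F Fs N) :
  (exists S : para_data M, is_induced_structure F Fs N S) /\
  (forall S : para_data M, is_induced_structure F Fs N S ->
     para_contact_like_metric (induced_metric gt f) S).
Proof.
have [hg hF hFs FF Fadj] := hMt.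
(* The adjoint of an involution is an involution: for [Y = Fs (Fs X) - X], moving both factors
   across gives [gt Y Y = gt (F (F Y)) X - gt Y X = 0]. *)
have FsFs q (X : tangent q) : Fs q (Fs q X) = X.
  apply/eqP; rewrite -subr_eq0; apply/eqP/(metric_eq0 hg).
  set Y := _ - X; rewrite {2}/Y -[_ - X]addrC -scaleN1r (metricPr hg).
  by rewrite -!Fadj FF mulN1r addNr.
split.
  have dec p (w : tangent (f p)) := cid (tangent_normal_decomp hg hM w).
  (* Tangency of [F N] and [Fs N] supplies [xi] and [xis]; the other fields are the two parts of the
     decomposition. The form [eta] comes from [Fs] and [etas] from [F]. *)
  exists (@ParaData R n M
    (fun p X => sval (dec p (F (f p) (differential f X))))
    (fun p X => sval (dec p (Fs (f p) (differential f X))))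
    (fun p => sval (cid (proj1 (hT p)))) (fun p => sval (cid (proj2 (hT p))))
    (fun p X => gt _ (Fs _ (differential f X)) (N p))
    (fun p X => gt _ (F _ (differential f X)) (N p))).
  split=> /= [p|p|p X|p X]; [| |exact: svalP (dec p _)|exact: svalP (dec p _)].
  - by rewrite (svalP (cid (proj1 (hT p)))).
  - by rewrite (svalP (cid (proj2 (hT p)))).
move=> S [FN FsN Fdf Fsdf]; split; last first.
  move=> p X Y.
  have E : gt _ (F _ (differential f X)) (Fs _ (differential f Y)) =
           gt _ (differential f X) (differential f Y) by rewrite -Fadj FF.
  by rewrite /induced_metric -E Fdf Fsdf (gt_tangent_normal hg hM) addrK.
split; first exact: (induced_metric_riemannian hg hM).
split; [|split].
- split; [exact: (induced_is_tensor11 hg hM hF Fdf)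
         |exact: (induced_is_tensor11 hg hM hFs Fsdf)| |].
  + split; [exact: (induced_is_vector_field hg hM hF FN)
           |exact: (induced_is_vector_field hg hM hFs FsN)].
  + split; [exact: (induced_is_one_form hg hM hFs Fsdf)
           |exact: (induced_is_one_form hg hM hF Fdf)].
(* Each group mixes the two structures: here the first two identities come from [F] and the last
   two, on [eta], [xis] and [phis], from [Fs]; in the next group the roles are exchanged. *)
- split=> p *.
  + exact: (proj1 (induced_sq hg hM hF FF FN Fdf _)).
  + exact: (proj1 (induced_vector hg hM FF FN Fdf _)).
  + exact: (proj2 (induced_vector hg hM FsFs FsN Fsdf _)).
  + exact: (proj2 (induced_sq hg hM hFs FsFs FsN Fsdf _)).
- split=> p *.
  + exact: (proj1 (induced_sq hg hM hFs FsFs FsN Fsdf _)).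
  + exact: (proj1 (induced_vector hg hM FsFs FsN Fsdf _)).
  + exact: (proj2 (induced_vector hg hM FF FN Fdf _)).
  + exact: (proj2 (induced_sq hg hM hF FF FN Fdf _)).
Qed.
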